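(* Let $p$ be a prime, let $H$ be a finite abelian $p$-group, and let $L(\mathcal{P}(H))$ be the Laplacian matrix of the power graph $\mathcal{P}(H)$. Then $H$ is cyclic if and only if for every non-zero eigenvalue $\lambda$ of $L(\mathcal{P}(H))$ there exists a basis $\mathcal{B}_\lambda$ of the corresponding eigenspace $E(\lambda)$ such that $\mathcal{D}(f_\lambda)=2$ for all $f_\lambda\in\mathcal{B}_\lambda$.
   Context: All graphs are finite, simple and undirected. The Laplacian matrix of a graph is $L=D-A$, where $A$ is the adjacency matrix and $D$ the diagonal matrix of vertex degrees. Power graph: for a group $H$, $\mathcal{P}(H)$ is the graph whose vertices are the elements of $H$, two distinct vertices $x,y$ being adjacent iff $x=y^a$ or $y=x^b$ for some $a,b\in\mathbb{N}$. Strong nodal domains: for a vector $g$ on $V(G)$ with no zero entry, a strong nodal domain of $g$ is a maximal connected subgraph $K$ of $G$ such that $g(i)g(j)>0$ for all $i,j\in V(K)$; equivalently, a connected component of the subgraph induced on $\{g>0\}$ or on $\{g<0\}$. Number of nodal decomposition $\mathcal{D}(f)$: for an eigenvector $f$ of $L(G)$, $\mathcal{D}(f)$ is the minimum, over all vectors $g$ with $g(v)=f(v)$ whenever $f(v)\ne 0$ and $g(v)\in\{-1,1\}$ whenever $f(v)=0$, of the number of strong nodal domains of $g$. *)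

(* Defs.v *)
From HB Require Import structures.
From mathcomp Require Import all_boot all_order all_algebra.
From mathcomp Require Import all_fingroup all_solvable.
From mathcomp Require Import boolp reals.

Set Implicit Arguments.
Unset Strict Implicit.
Unset Printing Implicit Defensive.

Import Order.TTheory GRing.Theory Num.Theory.

Local Open Scope ring_scope.

(* A graph on the vertex type T is given by its adjacency relation e, assumed
   symmetric and irreflexive.  A vector indexed by T is stored as a row vector
   through the enumeration of T. *)

Definition degree (T : finType) (e : rel T) (x : T) : nat :=
  #|[set y | e x y]|.

Definition adjacency_mx (R : realType) (T : finType) (e : rel T) :
    'M[R]_#|T| :=
  \matrix_(i, j) (e (enum_val i) (enum_val j))%:R.

Definition degree_mx (R : realType) (T : finType) (e : rel T) : 'M[R]_#|T| :=
  diag_mx (\row_i (degree e (enum_val i))%:R).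

(* Symmetric whenever e is, so that the row eigenvectors used by
   [eigenvalue] and [eigenspace] are the transposed column eigenvectors. *)
Definition laplacian_mx (R : realType) (T : finType) (e : rel T) :
    'M[R]_#|T| :=
  degree_mx R e - adjacency_mx R e.

Definition vertex_fun (R : realType) (T : finType) (f : 'rV[R]_#|T|) (x : T) :
    R :=
  f 0 (enum_rank x).

Definition power_graph (H : finGroupType) : rel H := fun x y =>
  (x != y) &&
  `[< (exists a : nat, x = (y ^+ a)%g) \/ (exists b : nat, y = (x ^+ b)%g) >].

Lemma power_graph_sym (H : finGroupType) : symmetric (@power_graph H).
Proof.
move=> x y; rewrite /power_graph eq_sym; congr (_ && _).
by apply/asboolP/asboolP => -[]; [right | left | right | left].
Qed.

Lemma power_graph_irrefl (H : finGroupType) : irreflexive (@power_graph H).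
Proof. by move=> x; rewrite /power_graph eqxx. Qed.

Definition connected_set (T : finType) (e : rel T) (K : {set T}) : bool :=
  (K != set0) &&
  [forall x in K, forall y in K,
    connect (fun u v => [&& u \in K, v \in K & e u v]) x y].

(* A subgraph that is maximal with these properties is induced, hence
   determined by its vertex set K. *)
Definition strong_nodal_domain (R : realType) (T : finType) (e : rel T)
    (g : T -> R) (K : {set T}) : bool :=
  maxset (fun K' : {set T} => connected_set e K' &&
            [forall i in K', forall j in K', 0 < g i * g j]) K.

Definition strong_nodal_count (R : realType) (T : finType) (e : rel T)
    (g : T -> R) : nat :=
  #|[set K | strong_nodal_domain e g K]|.

Definition sign_completion (R : realType) (T : finType) (f g : T -> R) : Prop :=
  (forall v, f v != 0 -> g v = f v) /\
  (forall v, f v = 0 -> g v = -1 \/ g v = 1).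

Definition completion_count (R : realType) (T : finType) (e : rel T)
    (f : T -> R) : pred nat := fun d =>
  `[< exists2 g : T -> R, sign_completion f g & strong_nodal_count e g = d >].

Lemma completion_count_ex (R : realType) (T : finType) (e : rel T)
    (f : T -> R) : exists d, completion_count e f d.
Proof.
pose g v := if f v == 0 then 1 else f v.
exists (strong_nodal_count e g); apply/asboolP; exists g => //.
split=> v; rewrite /g; first by move/negPf->.
by move->; rewrite eqxx; right.
Qed.

Definition nodal_decomposition_number (R : realType) (T : finType) (e : rel T)
    (f : T -> R) : nat :=
  ex_minn (completion_count_ex e f).

(* Main.v *)
Require Import Defs.
From HB Require Import structures.
From mathcomp Require Import all_boot all_order all_algebra.
From mathcomp Require Import all_fingroup all_solvable.
From mathcomp Require Import boolp reals.

Set Implicit Arguments.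
Unset Strict Implicit.
Unset Printing Implicit Defensive.

Import Order.TTheory GRing.Theory Num.Theory.

Local Open Scope ring_scope.

(** Write n for the order of H.

    If H is cyclic, its subgroups form a chain, so the power graph is complete
    ([power_graph_cyclic_pgroup]).  An eigenvector f for a non-zero eigenvalue
    has zero sum, hence takes both signs, and so does every completion g of f.
    In a complete graph the nodal domains of g are then exactly {g > 0} and
    {g < 0} ([strong_nodal_count_complete]).  Thus D(f) = 2 for every such f
    whatever the completion, and any basis of the eigenspace will do.

    If H is not cyclic, the eigenvalue n violates the condition.  The identity
    is adjacent to every other element, and deleting it disconnects the power
    graph: H has two distinct subgroups <x> and <y> of order p
    ([noncyclic_order_p]), and no edge joins an element u with x in <u> to a
    non-trivial element w with x not in <w> ([power_graph_disconnected]).  In any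
    graph with at least two vertices, a dominating vertex makes the number of
    vertices an eigenvalue ([dominated_eigenvalue]).  If deleting that vertex disconnects the graph,
    every eigenvector for this eigenvalue is constant off the vertex
    ([dominated_eigen_const]); having zero sum, it takes a non-zero value there,
    of the sign opposite to that at the vertex ([dominated_eigenvector]).  Such a
    vector has no zero entry to complete, and it has at least three nodal
    domains: one containing the dominating vertex and one on each side of the
    separation ([strong_nodal_count_cut]). *)

(** * The Laplacian as a difference operator *)

Lemma vertex_fun_mul_laplacian (R : realType) (T : finType) (e : rel T)
    (f : 'rV[R]_#|T|) (x : T) :
  symmetric e -> irreflexive e ->
  vertex_fun (f *m laplacian_mx R e) x =
    \sum_(y | e x y) (vertex_fun f x - vertex_fun f y).
Proof.
move=> e_sym e_irr; rewrite /vertex_fun mulmxBr mxE mul_mx_diag !mxE.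
rewrite sumrB sumr_const enum_rankK /degree cardsE mulr_natr; congr (_ - _).
rewrite (reindex (@enum_rank T)) /=; last exact: onW_bij (@enum_rank_bij T).
rewrite [RHS]big_mkcond; apply: eq_bigr => y _.
by rewrite mxE !enum_rankK e_sym; case: (e x y); rewrite ?mulr1 ?mulr0.
Qed.

Lemma eigen_laplacianP (R : realType) (T : finType) (e : rel T)
    (f : 'rV[R]_#|T|) (lambda : R) :
  symmetric e -> irreflexive e ->
  f *m laplacian_mx R e = lambda *: f <->
  (forall x, \sum_(y | e x y) (vertex_fun f x - vertex_fun f y) =
             lambda * vertex_fun f x).
Proof.
move=> e_sym e_irr; split=> [fL x | fL].
  by rewrite -vertex_fun_mul_laplacian // fL /vertex_fun mxE.
apply/rowP=> i; have := fL (enum_val i).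
rewrite -vertex_fun_mul_laplacian // /vertex_fun enum_valK => ->.
by rewrite mxE.
Qed.

Lemma vertex_fun_neq0 (R : realType) (T : finType) (f : 'rV[R]_#|T|) :
  f != 0 -> exists x, vertex_fun f x != 0.
Proof.
case/rV0Pn=> i fi; exists (enum_val i).
by rewrite /vertex_fun enum_valK.
Qed.

Lemma row_free_neq0 (R : realType) (m n : nat) (B : 'M[R]_(m, n)) (i : 'I_m) :
  row_free B -> row i B != 0.
Proof.
move=> B_free; apply/eqP; rewrite rowE => /(congr1 (mulmx^~ (pinvmx B))) /eqP.
rewrite mulmxKp // mul0mx; apply/negP/rV0Pn; exists i.
by rewrite mxE !eqxx oner_eq0.
Qed.

(** The sum over both orders of each edge of [f x - f y] cancels. *)
Lemma laplacian_eigen_sum0 (R : realType) (T : finType) (e : rel T)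
    (f : T -> R) (lambda : R) :
  symmetric e -> lambda != 0 ->
  (forall x, \sum_(y | e x y) (f x - f y) = lambda * f x) ->
  \sum_x f x = 0.
Proof.
move=> e_sym lambda0 fL; apply: (mulfI lambda0); rewrite mulr0 mulr_sumr.
under eq_bigr => x _ do rewrite -fL sumrB.
rewrite sumrB [X in _ - X](exchange_big_dep xpredT) //=.
under [X in _ - X]eq_bigr => y _ do under eq_bigl => x do rewrite e_sym.
by rewrite subrr.
Qed.

Lemma sum0_signs (R : realType) (T : finType) (f : T -> R) (x : T) :
  \sum_y f y = 0 -> f x != 0 -> (exists y, 0 < f y) /\ (exists y, f y < 0).
Proof.
(* A function of constant sign with zero sum vanishes. *)
have pos (g : T -> R) : \sum_y g y = 0 -> g x != 0 -> exists y, 0 < g y.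
  move=> g_sum gx; apply/existsP; apply: contraNT gx => /existsPn g_le0.
  have Ng_sum : \sum_y - g y = 0 by rewrite sumrN g_sum oppr0.
  rewrite -oppr_eq0; apply/eqP; apply: (psumr_eq0P _ Ng_sum) => // y _.
  by rewrite oppr_ge0 leNgt.
move=> f_sum fx; split; first exact: pos.
have [||y] := pos (fun y => - f y); first by rewrite sumrN f_sum oppr0.
  by rewrite oppr_eq0.
by rewrite oppr_gt0; exists y.
Qed.

(** * Nodal domains *)

Definition same_sign_connected (R : realType) (T : finType) (e : rel T)
    (g : T -> R) (K : {set T}) : bool :=
  connected_set e K && [forall i in K, forall j in K, 0 < g i * g j].

Lemma same_sign_connectedP (R : realType) (T : finType) (e : rel T)
    (g : T -> R) (K : {set T}) :
  reflect (connected_set e K /\ {in K &, forall i j, 0 < g i * g j})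
          (same_sign_connected e g K).
Proof.
apply: (iffP andP) => -[K_conn K_sign]; split=> //.
  by move=> i j iK jK; apply: (forall_inP (forall_inP K_sign i iK)).
by apply/forall_inP=> i iK; apply/forall_inP=> j jK; apply: K_sign.
Qed.

Lemma strong_nodal_domainE (R : realType) (T : finType) (e : rel T)
    (g : T -> R) (K : {set T}) :
  strong_nodal_domain e g K = maxset (same_sign_connected e g) K.
Proof. by []. Qed.

Lemma exists_strong_nodal_domain (R : realType) (T : finType) (e : rel T)
    (g : T -> R) (x : T) :
  g x != 0 -> exists2 K, strong_nodal_domain e g K & x \in K.
Proof.
move=> gx.
have [|K K_dom] := @maxset_exists _ (same_sign_connected e g) [set x].
  apply/same_sign_connectedP; split.
    apply/andP; split; first by apply/set0Pn; exists x; rewrite inE.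
    by apply/forall_inP=> y /set1P->; apply/forall_inP=> z /set1P->.
  by move=> i j /set1P-> /set1P->; rewrite -expr2 exprn_even_gt0.
by rewrite sub1set => xK; exists K.
Qed.

Lemma clique_connected (T : finType) (e : rel T) (K : {set T}) :
  K != set0 -> {in K &, forall x y, x != y -> e x y} -> connected_set e K.
Proof.
move=> K0 K_clique; rewrite /connected_set K0 /=.
apply/forall_inP=> x xK; apply/forall_inP=> y yK.
have [->|xy] := eqVneq x y; first exact: connect0.
by apply: connect1; rewrite xK yK K_clique.
Qed.

(** All vertices of one sign form a clique, so maximality forces a nodal domain
    to be a whole sign class. *)
Lemma strong_nodal_domain_complete (R : realType) (T : finType) (e : rel T)
    (g : T -> R) (K : {set T}) :
  (forall x y, x != y -> e x y) ->
  strong_nodal_domain e g K <->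
  (exists2 a, g a != 0 & K = [set v | 0 < g a * g v]).
Proof.
move=> e_complete; rewrite strong_nodal_domainE.
have sign_class a : g a != 0 ->
    same_sign_connected e g [set v | 0 < g a * g v].
  move=> ga; have aa : 0 < g a * g a by rewrite -expr2 exprn_even_gt0.
  apply/same_sign_connectedP; split; last first.
    move=> i j; rewrite !inE => ai aj.
    by rewrite -(pmulr_rgt0 _ aa) mulrACA mulr_gt0.
  apply: clique_connected; first by apply/set0Pn; exists a; rewrite inE.
  by move=> x y _ _; apply: e_complete.
split=> [/maxsetP[/same_sign_connectedP[/andP[/set0Pn[a aK] _] K_sign] K_max]|].
  have ga : g a != 0.
    by have := K_sign a a aK aK; apply: contraTneq => ->; rewrite mul0r ltxx.
  exists a => //; apply/esym/K_max; first exact: sign_class.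
  by apply/subsetP=> v vK; rewrite inE K_sign.
case=> a ga ->; apply/maxsetP; split; first exact: sign_class.
move=> K' /same_sign_connectedP[_ K'_sign] sub_K'.
have aK' : a \in K'.
  by apply: (subsetP sub_K'); rewrite inE -expr2 exprn_even_gt0.
apply/eqP; rewrite eqEsubset sub_K' andbT.
by apply/subsetP=> v vK'; rewrite inE K'_sign.
Qed.

Lemma strong_nodal_count_complete (R : realType) (T : finType) (e : rel T)
    (g : T -> R) (a b : T) :
  (forall x y, x != y -> e x y) -> 0 < g a -> g b < 0 ->
  strong_nodal_count e g = 2%N.
Proof.
move=> e_complete ga gb.
rewrite /strong_nodal_count.
have -> : [set K | strong_nodal_domain e g K] =
    [set [set v | 0 < g v]; [set v | g v < 0]].
  have classE c : g c != 0 -> [set v | 0 < g c * g v] =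
      if 0 < g c then [set v | 0 < g v] else [set v | g v < 0].
    move=> gc; apply/setP=> v; rewrite inE.
    have [gc_gt0|gc_lt0|gc0] := ltrgt0P (g c); last by rewrite gc0 eqxx in gc.
      by rewrite inE pmulr_rgt0.
    by rewrite inE nmulr_rgt0.
  apply/setP=> K; rewrite in_set in_set2; apply/idP/idP.
    case/(strong_nodal_domain_complete _ _ e_complete) => c gc ->.
    by rewrite classE //; case: ifP; rewrite eqxx ?orbT.
  move=> KE; apply/(strong_nodal_domain_complete _ _ e_complete).
  case/orP: KE => /eqP->; first by exists a; rewrite ?classE ?ga ?gt_eqF.
  exists b; first by rewrite lt_eqF.
  by rewrite classE ?lt_eqF // ltNge ltW.
rewrite cards2; suff -> : [set v | 0 < g v] != [set v | g v < 0] by [].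
by apply/eqP=> /setP/(_ a); rewrite !inE ga ltNge ltW.
Qed.

(** The nodal domains of [x] and [y] have the sign opposite to that of [g c], so
    they avoid [c] and cannot cross from [A] to the rest of the graph. *)
Lemma strong_nodal_count_cut (R : realType) (T : finType) (e : rel T)
    (g : T -> R) (c x y : T) (A : {set T}) :
  g c * g x < 0 -> g c * g y < 0 -> x \in A -> y \notin A ->
  (forall u w, u != c -> w != c -> u \in A -> w \notin A -> ~~ e u w) ->
  (2 < strong_nodal_count e g)%N.
Proof.
move=> gcx gcy xA yA cut.
have nz u v : g u * g v < 0 -> g u != 0 /\ g v != 0.
  by move/lt_eqF/negbT; rewrite mulf_eq0 negb_or => /andP[].
have [gc gx] := nz _ _ gcx; have [_ gy] := nz _ _ gcy.
have [Kc Kc_dom cK] := exists_strong_nodal_domain e gc.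
have [Kx Kx_dom xK] := exists_strong_nodal_domain e gx.
have [Ky Ky_dom yK] := exists_strong_nodal_domain e gy.
have opp K u : strong_nodal_domain e g K -> g c * g u < 0 -> u \in K ->
    c \notin K.
  case/maxsetP=> /same_sign_connectedP[_ K_sign] _ gcu uK.
  by apply/negP=> cK'; have := K_sign c u cK' uK; rewrite ltNge ltW.
have Kcx : Kc != Kx by apply: contraTneq cK => ->; apply: (opp _ x).
have Kcy : Kc != Ky by apply: contraTneq cK => ->; apply: (opp _ y).
have Kxy : Kx != Ky.
  apply: contraTneq yK => <-; apply/negP=> yKx; case/negP: yA.
  have cKx : c \notin Kx by apply: (opp _ x).
  case/maxsetP: Kx_dom => /same_sign_connectedP[/andP[_ /forall_inP conn] _] _.
  have /connectP[s s_path ->] := forall_inP (conn x xK) y yKx.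
  elim: s x xA s_path {gcx gx xK conn Kcx} => //= w s IHs u uA.
  case/andP=> /and3P[uK wK uw]; apply: IHs.
  apply: contraTT uw => wA; apply: cut => //.
    by apply: contraNneq cKx => <-.
  by apply: contraNneq cKx => <-.
rewrite /strong_nodal_count.
have <- : #|[set Kc; Kx; Ky]| = 3%N.
  by rewrite setUC cardsU1 cards2 Kcx !inE negb_or ![Ky == _]eq_sym Kcy Kxy.
by apply: subset_leq_card; apply/subsetP=> K;
   rewrite !inE -orbA => /or3P[] /eqP->.
Qed.

(** * Graphs with a dominating vertex *)

(** With n the number of vertices and d the indicator of the dominating vertex,
    the Laplacian maps d to n d - 1 and kills constants; so n d - 1 is an
    eigenvector for n. *)
Lemma dominated_eigenvalue (R : realType) (T : finType) (e : rel T) (c x : T) :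
  symmetric e -> irreflexive e -> (forall y, y != c -> e c y) -> x != c ->
  eigenvalue (laplacian_mx R e) #|T|%:R.
Proof.
move=> e_sym e_irr dom xc; apply/eigenvalueP.
pose f : 'rV[R]_#|T| := \row_i (#|T|%:R * (enum_val i == c)%:R - 1).
have fE y : vertex_fun f y = #|T|%:R * (y == c)%:R - 1.
  by rewrite /vertex_fun mxE enum_rankK.
exists f; last first.
  apply/eqP=> f0; have := fE x.
  rewrite f0 /vertex_fun mxE (negPf xc) mulr0 sub0r.
  by move/eqP; rewrite eq_sym oppr_eq0 oner_eq0.
apply/eigen_laplacianP => // y; rewrite fE.
under eq_bigr => z _ do rewrite !fE opprB addrA subrK -mulrBr.
rewrite -mulr_sumr; congr (_ * _).
have [->|yc] := eqVneq y c.
  under eq_bigl => z.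
    have -> : e c z = (z != c).
      by apply/idP/idP => [|/dom //]; apply: contraTneq => ->; rewrite e_irr.
    over.
  rewrite mulr1 (eq_bigr (fun=> 1)); last by move=> z /negPf->; rewrite subr0.
  by rewrite sumr_const cardC1 -subn1 natrB //; apply/card_gt0P; exists c.
rewrite mulr0 (bigD1 c) /=; last by rewrite e_sym dom.
rewrite eqxx big1 ?addr0 // => z /andP[_ /negPf->].
by rewrite subrr.
Qed.

(** The equation at the dominating vertex says that f has zero sum.  Then
    [f x - f y] sums to [#|T|%:R * f x] over all y, which is already its sum over the
    neighbours of x; so f is harmonic for the complementary graph. *)
Lemma dominated_harmonic (R : realType) (T : finType) (e : rel T)
    (f : T -> R) (c : T) :
  (forall y, y != c -> e c y) ->
  (forall x, \sum_(y | e x y) (f x - f y) = #|T|%:R * f x) ->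
  \sum_y f y = 0 /\ (forall x, \sum_(y | ~~ e x y) (f x - f y) = 0).
Proof.
move=> dom fL.
have total x : \sum_y (f x - f y) = #|T|%:R * f x - \sum_y f y.
  by rewrite sumrB sumr_const mulr_natl.
have f_sum : \sum_y f y = 0.
  have := total c; rewrite (bigID (e c)) /= fL big1 ?addr0.
    by move/eqP; rewrite -subr_eq0 opprB addrC addrNK => /eqP.
  move=> y; have [->|/dom->//] := eqVneq y c; first by rewrite subrr.
split=> // x; have := total x; rewrite (bigID (e x)) /= fL f_sum subr0.
by move/eqP; rewrite -subr_eq0 addrAC subrr add0r => /eqP.
Qed.

(** The maximum principle for the complementary graph, in which every vertex of
    [A] is joined to every vertex off [A]: a maximum on one side spreads to the
    whole other side, and from there back. *)
Lemma dominated_eigen_const (R : realType) (T : finType) (e : rel T)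
    (f : T -> R) (c a b : T) (A : {set T}) :
  symmetric e -> (forall y, y != c -> e c y) ->
  (forall u w, u != c -> w != c -> u \in A -> w \notin A -> ~~ e u w) ->
  a != c -> a \in A -> b != c -> b \notin A ->
  (forall x, \sum_(y | e x y) (f x - f y) = #|T|%:R * f x) ->
  exists M, forall x, x != c -> f x = M.
Proof.
move=> e_sym dom cut ac aA bc bA fL.
have [_ harm] := dominated_harmonic dom fL.
pose m := [arg max_(x > a | x != c) f x]%O.
have m_max : m != c /\ (forall y, y != c -> f y <= f m).
  by rewrite /m; case: arg_maxP.
exists (f m).
have spread x y : x != c -> f x = f m -> ~~ e x y -> f y = f m.
  move=> xc fx xy; apply/eqP; rewrite eq_sym -subr_eq0 -fx; apply/eqP.
  apply: (psumr_eq0P _ (harm x)) => // z xz; rewrite subr_ge0 fx m_max.2 //.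
  by apply: contraNneq xz => ->; rewrite e_sym dom.
have cross x y : x != c -> y != c -> (x \in A) != (y \in A) ->
    f x = f m -> f y = f m.
  move=> xc yc xyA fx; apply: (spread x) => //.
  case xA: (x \in A) xyA; case yA: (y \in A) => // _.
    by rewrite cut // yA.
  by rewrite e_sym cut // xA.
(* A vertex off c on the side that does not contain m. *)
pose m' := if m \in A then b else a.
have m'c : m' != c by rewrite /m'; case: ifP.
have m'A : (m' \in A) = (m \notin A).
  by rewrite /m'; case: ifP; rewrite ?aA // (negPf bA).
have fm' : f m' = f m.
  by apply: (cross m) => //; [case: m_max | rewrite m'A; case: (m \in A)].
move=> x xc; have [xmA|xmA] := eqVneq (m \in A) (x \in A).
  by apply: (cross m') => //; rewrite m'A xmA; case: (x \in A).
by apply: (cross m) => //; case: m_max.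
Qed.

Lemma dominated_eigenvector (R : realType) (T : finType) (e : rel T)
    (f : T -> R) (c a b : T) (A : {set T}) :
  symmetric e -> (forall y, y != c -> e c y) ->
  (forall u w, u != c -> w != c -> u \in A -> w \notin A -> ~~ e u w) ->
  a != c -> a \in A -> b != c -> b \notin A ->
  (forall x, \sum_(y | e x y) (f x - f y) = #|T|%:R * f x) ->
  (exists x, f x != 0) ->
  forall x, x != c -> f c * f x < 0.
Proof.
move=> e_sym dom cut ac aA bc bA fL [z fz].
have [M fM] := dominated_eigen_const e_sym dom cut ac aA bc bA fL.
have [f_sum _] := dominated_harmonic dom fL.
move: f_sum; rewrite (bigD1 c) //= (eq_bigr _ fM) sumr_const cardC1.
have : (0 < #|T|.-1)%N by rewrite -(cardC1 c); apply/card_gt0P; exists a.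
move: #|T|.-1 => k k0 /eqP; rewrite addr_eq0 => /eqP fc.
have M0 : M != 0.
  apply: contraNneq fz => M0; have [->|/fM->] := eqVneq z c; last by rewrite M0.
  by rewrite fc M0 mul0rn oppr0.
move=> x /fM->; rewrite fc mulNr oppr_lt0 mulrnAl pmulrn_lgt0 //.
by rewrite -expr2 exprn_even_gt0.
Qed.

Lemma nodal_decomposition_number_nonzero (R : realType) (T : finType)
    (e : rel T) (f : T -> R) :
  (forall x, f x != 0) ->
  nodal_decomposition_number e f = strong_nodal_count e f.
Proof.
move=> f0; rewrite /nodal_decomposition_number; case: ex_minnP => d.
case/asboolP=> g [gf _] <- _; congr strong_nodal_count.
by apply/funext => x; apply: gf.
Qed.

(** * Power graphs of p-groups *)

Lemma power_graphE (H : finGroupType) (x y : H) :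
  power_graph x y = (x != y) && ((x \in <[y]>%g) || (y \in <[x]>%g)).
Proof.
rewrite /power_graph; congr (_ && _); apply/asboolP/orP.
  by case=> -[a ->]; [left | right]; apply: mem_cycle.
by case=> /cycleP[a ->]; [left | right]; exists a.
Qed.

(** Of two powers of p, one divides the other, and the subgroups of a cyclic
    group are ordered as their orders are. *)
Lemma cyclic_pgroup_comparable (p : nat) (gT : finGroupType)
    (G : {group gT}) (x y : gT) :
  prime p -> (p.-group G)%g -> cyclic G -> x \in G -> y \in G ->
  (x \in <[y]>%g) || (y \in <[x]>%g).
Proof.
move=> p_prime pG cycG xG yG.
have [m xm] := p_natP (mem_p_elt pG xG).
have [n yn] := p_natP (mem_p_elt pG yG).
have sub u v : u \in G -> v \in G -> (#[u]%g %| #[v]%g)%N -> u \in <[v]>%g.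
  move=> uG vG uv; have := cardSg_cyclic cycG.
  by move=> /(_ <[u]>%G <[v]>%G); rewrite !cycle_subG => <-.
case/orP: (leq_total m n) => /(dvdn_exp2l p); rewrite -xm -yn.
  by move/(sub _ _ xG yG) => ->.
by move/(sub _ _ yG xG) => ->; rewrite orbT.
Qed.

Lemma power_graph_cyclic_pgroup (p : nat) (H : finGroupType) (x y : H) :
  prime p -> (p.-group [set: H])%g -> cyclic [set: H] -> x != y ->
  power_graph x y.
Proof.
move=> p_prime pH cycH xy; rewrite power_graphE xy.
by apply: (cyclic_pgroup_comparable p_prime pH cycH); rewrite inE.
Qed.

(** A non-cyclic abelian p-group has rank at least 2, so its elements of order
    dividing p are not all contained in one cyclic subgroup. *)
Lemma noncyclic_order_p (p : nat) (gT : finGroupType) (G : {group gT}) :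
  prime p -> abelian G -> (p.-group G)%g -> ~~ cyclic G ->
  exists x y : gT, [/\ #[x]%g = p, #[y]%g = p & x \notin <[y]>%g].
Proof.
move=> p_prime abG pG ncycG.
have abelE := Ohm1_abelem pG abG.
have rankE : (1 < logn p #|'Ohm_1(G)%g|)%N.
  by rewrite -(rank_abelem abelE) rank_Ohm1 ltnNge -abelian_rank1_cyclic.
have cardE : (p < #|'Ohm_1(G)%g|)%N.
  rewrite (card_pgroup (abelem_pgroup abelE)) -[ltnLHS]expn1.
  by rewrite ltn_exp2l ?(prime_gt1 p_prime).
have ord z : z \in 'Ohm_1(G)%g -> z != 1%g -> #[z]%g = p.
  by move=> zE; apply: abelem_order_p abelE zE.
have [y yE y1] : exists2 y, y \in 'Ohm_1(G)%g & y != 1%g.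
  apply/trivgPn; rewrite trivg_card1.
  by rewrite gtn_eqF // (leq_trans _ cardE) // ltnS prime_gt0.
have /subsetPn[x xE xy] : ~~ ('Ohm_1(G)%g \subset <[y]>%g).
  apply/negP=> /subset_leq_card; rewrite leqNgt -orderE ord //.
  by rewrite cardE.
exists x, y; split=> //; apply: ord => //.
by apply: contraNneq xy => ->; apply: group1.
Qed.

(** In a cyclic p-group every non-trivial subgroup contains the unique subgroup
    of order p; hence deleting the identity separates the elements having [x]
    among their powers from the others. *)
Lemma power_graph_disconnected (p : nat) (H : finGroupType) (x u w : H) :
  prime p -> (p.-group [set: H])%g -> #[x]%g = p -> w != 1%g ->
  x \in <[u]>%g -> x \notin <[w]>%g -> ~~ power_graph u w.
Proof.
move=> p_prime pH ox w1 xu xw.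
apply: contra xw; rewrite power_graphE => /andP[_ /orP[uw | wu]].
  by apply: (subsetP _ _ xu); rewrite cycle_subG.
have pu : (p.-group <[u]>)%g by apply: pgroupS pH; apply: subsetT.
case/orP: (cyclic_pgroup_comparable p_prime pu (cycle_cyclic u) xu wu) => // wx.
(* <w> is a non-trivial subgroup of <x>, which has prime order. *)
have : (#[w]%g %| p)%N by rewrite -ox; apply: order_dvdG.
case/primeP: p_prime => _ p_div /p_div /orP[].
  by rewrite order_eq1 (negPf w1).
move/eqP=> ow; have -> : <[w]>%g = <[x]>%g; last exact: cycle_id.
by apply/eqP; rewrite eqEcard cycle_subG wx -!orderE ow ox /=.
Qed.

Theorem theorem2p13 (R : realType) (p : nat) (H : finGroupType)
    (p_prime : prime p) (H_abelian : abelian [set: H])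
    (H_pgroup : (p.-group [set: H])%g) :
  cyclic [set: H] <->
  (forall lambda : R,
     eigenvalue (laplacian_mx R (@power_graph H)) lambda ->
     lambda != 0 ->
     exists (m : nat) (B : 'M[R]_(m, #|H|)),
       [/\ row_free B,
           (B :=: eigenspace (laplacian_mx R (@power_graph H)) lambda)%MS
         & forall i : 'I_m,
             nodal_decomposition_number (@power_graph H)
               (vertex_fun (row i B)) = 2%N]).
Proof.
have e_sym := @power_graph_sym H; have e_irr := @power_graph_irrefl H.
split=> [cycH lambda _ lambda0 | basis].
  have complete (x y : H) :=
    @power_graph_cyclic_pgroup p H x y p_prime H_pgroup cycH.
  exists _, (row_base (eigenspace (laplacian_mx R (@power_graph H)) lambda)).
  split=> [||i]; [exact: row_base_free | exact: eq_row_base |].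
  set f := row i _.
  have [x fx] : exists x, vertex_fun f x != 0.
    by apply/vertex_fun_neq0/row_free_neq0/row_base_free.
  have /eigenspaceP/eigen_laplacianP fL :
      (f <= eigenspace (laplacian_mx R (@power_graph H)) lambda)%MS.
    by rewrite (submx_trans (row_sub _ _)) // eq_row_base.
  have f_sum := laplacian_eigen_sum0 e_sym lambda0 (fL e_sym e_irr).
  have [[a fa] [b fb]] := sum0_signs f_sum fx.
  rewrite /nodal_decomposition_number; case: ex_minnP => d.
  case/asboolP=> g [gf _] <- _.
  apply: (@strong_nodal_count_complete _ _ _ _ a b) => //.
    by rewrite gf // gt_eqF.
  by rewrite gf // lt_eqF.
apply: contraT => ncycH.
have [x [y [ox oy xy]]] := noncyclic_order_p p_prime H_abelian H_pgroup ncycH.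
have neq1 (z : H) : #[z]%g = p -> z != 1%g.
  by move=> oz; rewrite -order_gt1 oz prime_gt1.
have dom (z : H) : z != 1%g -> power_graph 1%g z.
  by move=> z1; rewrite power_graphE eq_sym z1 group1.
pose A := [set u : H | x \in <[u]>%g].
have cut (u w : H) : u != 1%g -> w != 1%g -> u \in A -> w \notin A ->
    ~~ power_graph u w.
  rewrite !inE => _ w1; exact: (power_graph_disconnected p_prime).
have xA : x \in A by rewrite inE cycle_id.
have yA : y \notin A by rewrite inE.
have n0 : #|H|%:R != 0 :> R.
  by rewrite pnatr_eq0 -lt0n; apply/card_gt0P; exists x.
have eigen_n := dominated_eigenvalue R e_sym e_irr dom (neq1 x ox).
have [m [B [B_free B_eigen B_nodal]]] := basis _ eigen_n n0.
have m0 : (0 < m)%N.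
  by rewrite -(eqnP B_free) lt0n mxrank_eq0 -submx0 B_eigen submx0.
pose f := row (Ordinal m0) B.
have /eigenspaceP/eigen_laplacianP fL :
    (f <= eigenspace (laplacian_mx R (@power_graph H)) #|H|%:R)%MS.
  by rewrite -B_eigen row_sub.
have f_nz := vertex_fun_neq0 (row_free_neq0 (Ordinal m0) B_free).
have [x1 y1] := (neq1 x ox, neq1 y oy).
have f_sign :=
  dominated_eigenvector e_sym dom cut x1 xA y1 yA (fL e_sym e_irr) f_nz.
have := strong_nodal_count_cut (f_sign x x1) (f_sign y y1) xA yA cut.
rewrite -nodal_decomposition_number_nonzero; first by rewrite B_nodal.
have nz z : z != 1%g -> vertex_fun f 1%g != 0 /\ vertex_fun f z != 0.
  by move/f_sign/lt_eqF/negbT; rewrite mulf_eq0 negb_or => /andP[].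
move=> z; have [->|/nz[]//] := eqVneq z 1%g.
by case: (nz x x1).
Qed.
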